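(* Let $U=(0,0)$, $A=(18,24)$, $V=(50,0)$, $B=(32,-24)$. Then the set of rational points $P$ on the open segment $UV$ such that the Euclidean distances $PU,PV,PA,PB$ are all rational is exactly $\{(25,0)\}$. Equivalently, the only rational point strictly between $U$ and $V$ whose distances from all four points $U,A,V,B$ are rational is the midpoint $(25,0)$.
   Context: A rational point is a point with both coordinates in $\mathbb{Q}$. *)

(* Defs.v *)
From mathcomp Require Import all_boot all_order all_algebra.
From mathcomp Require Import boolp classical_sets reals.

Set Implicit Arguments.
Unset Strict Implicit.
Unset Printing Implicit Defensive.

Import Order.TTheory GRing.Theory Num.Theory.

Local Open Scope ring_scope.
Local Open Scope classical_set_scope.

(* Spelled out because the library norm on [R * R] is the sup norm. *)
Definition edist (R : realType) (P Q : R * R) : R :=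
  Num.sqrt ((P.1 - Q.1) ^+ 2 + (P.2 - Q.2) ^+ 2).

Definition rational_point (R : realType) (P : R * R) : Prop :=
  rational P.1 /\ rational P.2.

Definition open_segment (R : realType) (P Q : R * R) : set (R * R) :=
  [set ((1 - t) * P.1 + t * Q.1, (1 - t) * P.2 + t * Q.2)
    | t in [set t : R | 0 < t < 1]].

(* Main.v *)
(** Writing P = (x, 0) and y = 50 - x, rationality of PA and PB says that
    16 x^2 + 9 y^2 and 9 x^2 + 16 y^2 are rational squares; one has to show
    x = y.  This is done by infinite descent on m^2 + n^2 for positive integral
    solutions m <> n of
      E1 : 16 m^2 + 9 n^2 = u^2,   9 m^2 + 16 n^2 = v^2,
    passing through the 2-isogenous genus one curve
      E2 : 25 x^2 + 144 y^2 = z^2,   4 x^2 + 25 y^2 = w^2.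
    A product of two quadratic forms which is a square splits into squares up to
    the gcd of its factors, which divides a resultant (175, 576 or 49).
    - From E1: as (4v + 3u) (4v - 3u) = 7 (5n)^2, the ratio of the factors is
      7 x^2 : y^2, and (25 x^2 - y^2) (49 x^2 - 25 y^2) is a square.  Modulo 5 the
      common factor is k = 1 or 6 up to squares.
    - The curve 25 x^2 - y^2 = k f^2, 49 x^2 - 25 y^2 = k c^2 maps to E2: for
      k = 1 by (c, 2y), for k = 6 through the factorisation
      6 (xf + yc) (xf - yc) = (5 (x^2 - y^2))^2.
    - From E2: (z + 5x) (z - 5x) = (12 y)^2 gives z + 5x : z - 5x = m^2 : n^2 and
      (m, n) lies on E1 again, by congruences modulo 3 and 7.
    The new m^2 + n^2 is at most of the order of the fourth root of the old one;
    the finitely many m, n <= 49 for which it need not decrease are checked by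
    computation. *)
Require Import Defs.
From Stdlib Require Import BinInt.
From mathcomp Require Import all_boot all_order all_algebra.
From mathcomp Require Import boolp classical_sets reals.
From mathcomp Require Import zify ring lra.

Set Implicit Arguments.
Unset Strict Implicit.
Unset Printing Implicit Defensive.

Import Order.TTheory GRing.Theory Num.Theory.

Local Open Scope ring_scope.
Local Open Scope classical_set_scope.

(** * Square products, common divisors and residue tests for integers *)

(** Dividing by the gcd leaves coprime cofactors whose product is a square [d ^+ 2]; each is then
    the square of its gcd with [d]. *)
Lemma mul_sqr_split (a b c : int) : 0 < a -> 0 < b -> a * b = c ^+ 2 ->
  exists g u v : int, [/\ 0 < g, 0 < u, 0 < v, coprimez u v
    & a = g * u ^+ 2 /\ b = g * v ^+ 2].
Proof.
move=> a_gt0 b_gt0 abE.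
pose g := gcdz a b.
have g_gt0 : 0 < g by rewrite lt_def gcdz_eq0 negb_and gt_eqF.
have [/dvdzP[a' aE] /dvdzP[b' bE]] := (dvdz_gcdl a b, dvdz_gcdr a b).
rewrite -/g in aE bE.
have a'_gt0 : 0 < a' by move: a_gt0; rewrite aE pmulr_lgt0.
have b'_gt0 : 0 < b' by move: b_gt0; rewrite bE pmulr_lgt0.
have co : coprimez a' b'.
  rewrite /coprimez; apply/eqP/(mulIf (lt0r_neq0 g_gt0)).
  by have := mulz_gcdl a' b' g; rewrite gtz0_abs // mul1r -aE -bE.
have /dvdzP[d cE] : (g %| c)%Z.
  rewrite dvdzE -(@dvdn_pexp2r _ _ 2) // -!abszX -dvdzE -abE aE bE mulrACA.
  exact: dvdz_mull.
have abd : a' * b' = d ^+ 2.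
  apply: (mulIf (lt0r_neq0 (mulr_gt0 g_gt0 g_gt0))).
  by rewrite -mulrACA -aE -bE abE cE exprMn expr2.
have d_neq0 : d != 0.
  apply: contraTneq (mulr_gt0 a'_gt0 b'_gt0) => d0.
  by rewrite abd d0 expr0n ltxx.
(* With x = x' e and d = d' e one gets x' y = e d'^2. As x' is prime to d' and e is prime to y, x'
   and e divide each other. *)
have gcd_sqr x y : coprimez x y -> 0 < x -> x * y = d ^+ 2 -> x = gcdz x d ^+ 2.
  move=> xy x_gt0 xyd.
  have [/dvdzP[x' xE] /dvdzP[d' dE]] := (dvdz_gcdl x d, dvdz_gcdr x d).
  set e := gcdz x d in xE dE *.
  have e_gt0 : 0 < e by rewrite lt_def gcdz_eq0 negb_and gt_eqF.
  have x'_gt0 : 0 < x' by move: x_gt0; rewrite xE pmulr_lgt0.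
  have x'd' : coprimez x' d'.
    rewrite /coprimez; apply/eqP/(mulIf (lt0r_neq0 e_gt0)).
    by have := mulz_gcdl x' d' e; rewrite gtz0_abs // mul1r -xE -dE.
  have x'y : x' * y = e * d' ^+ 2.
    apply: (mulfI (lt0r_neq0 e_gt0)).
    by rewrite mulrA (mulrC e) -xE xyd dE; ring.
  have x'e : (x' %| e)%Z.
    by rewrite -(@Gauss_dvdzl _ _ (d' ^+ 2)) ?coprimezXr // -x'y dvdz_mulr.
  have ex' : (e %| x')%Z.
    rewrite -(@Gauss_dvdzl _ _ y) ?x'y ?dvdz_mulr //.
    by rewrite coprimezE; apply: coprime_dvdl xy; rewrite -dvdzE xE dvdz_mull.
  suff ee : x' = e by rewrite {1}xE ee expr2.
  apply/eqP; rewrite -(gtz0_abs e_gt0) -(gtz0_abs x'_gt0) eqz_nat eqn_dvd.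
  by rewrite -!dvdzE x'e.
exists g, (gcdz a' d), (gcdz b' d); split => //.
- by rewrite lt_def gcdz_eq0 negb_and gt_eqF.
- by rewrite lt_def gcdz_eq0 negb_and gt_eqF.
- rewrite coprimezE (coprime_dvdl _ (coprime_dvdr _ co)) // -dvdzE.
  + exact: dvdz_gcdl.
  + exact: dvdz_gcdl.
- rewrite -(gcd_sqr a' b') // -(gcd_sqr b' a') ?(mulrC g) //.
  + by rewrite coprimez_sym.
  + by rewrite mulrC.
Qed.

Lemma sqr_quotient (t a c : int) : t != 0 -> t ^+ 2 * a = c ^+ 2 ->
  exists d, a = d ^+ 2.
Proof.
move=> t0 taE.
have /dvdzP[d cE] : (t %| c)%Z.
  by rewrite dvdzE -(@dvdn_pexp2r _ _ 2) // -!abszX -dvdzE -taE dvdz_mulr.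
exists d; apply: (mulfI (expf_neq0 2 t0)).
by rewrite taE cE exprMn mulrC.
Qed.

(** In use, [g] divides the values of two diagonal forms at [x], [y], and [k] is their determinant:
    eliminating either square leaves [k] times the other. *)
Lemma coprimez_dvd_mul_sqr (g k x y : int) : coprimez x y ->
  (g %| k * x ^+ 2)%Z -> (g %| k * y ^+ 2)%Z -> (g %| k)%Z.
Proof.
move=> xy gx gy.
have : (g %| gcdz (k * x ^+ 2) (k * y ^+ 2))%Z by rewrite dvdz_gcd gx.
have /eqP xy2 : coprimez (x ^+ 2) (y ^+ 2) by rewrite coprimezXl ?coprimezXr.
rewrite -mulz_gcdr xy2 mulr1.
by rewrite !dvdzE.
Qed.

Lemma coprimez_not_common (p x y : int) : coprimez x y -> 1 < p ->
  (p %| x)%Z -> (p %| y)%Z -> False.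
Proof.
move=> /eqP xy p_gt1 px py.
have : (p %| 1)%Z by rewrite -[1%Z]xy dvdz_gcd px.
by rewrite dvdzE dvdn1 => /eqP; lia.
Qed.

Lemma modz_form (p k x y : int) :
  ((x ^+ 2 + k * y ^+ 2) %% p)%Z =
  (((x %% p)%Z ^+ 2 + k * (y %% p)%Z ^+ 2) %% p)%Z.
Proof. by rewrite -modzDm -modzXm -modzMmr -(modzXm 2 y) modzMmr modzDm. Qed.

(** A finite table of residues, so that concrete instances hold by evaluation. *)
Definition anisotropic_mod (p : nat) (k : int) : bool :=
  all (fun r : nat => all (fun s : nat =>
    (p %| r%:Z ^+ 2 + k * s%:Z ^+ 2)%Z ==> (r == 0%N) && (s == 0%N))
    (iota 0 p)) (iota 0 p).

Lemma anisotropic_modP (p : nat) (k x y : int) :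
  (0 < p)%N -> anisotropic_mod p k -> (p %| x ^+ 2 + k * y ^+ 2)%Z ->
  (p %| x)%Z /\ (p %| y)%Z.
Proof.
move=> p_gt0 ani; rewrite !(sameP dvdz_mod0P eqP) modz_form.
have small (z : int) : exists2 r : nat, (z %% p)%Z = r & r \in iota 0 p.
  have p_neq0 : p%:Z != 0 by lia.
  exists `|(z %% p)%Z|%N; first by rewrite gez0_abs ?modz_ge0.
  by rewrite mem_iota add0n /= -ltz_nat gez0_abs ?modz_ge0 ?ltz_pmod.
have [[r -> rI] [s -> sI]] := (small x, small y).
rewrite -(sameP dvdz_mod0P eqP).
by move: ani => /allP/(_ r rI)/allP/(_ s sI)/implyP rs /rs /andP[/eqP-> /eqP->].
Qed.

Lemma dvdz_divisors (g : int) (n : nat) : (0 < n)%N -> 0 < g -> (g %| n%:Z)%Z ->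
  exists2 d : nat, g = d & d \in divisors n.
Proof.
case: g => // d n_gt0 _; rewrite dvdzE => dn.
by exists d; rewrite -?dvdn_divisors.
Qed.

(** * Descent maps between the genus one curves *)

Lemma E1_of_E2 (x y z w : int) : 0 < x -> 0 < y -> 0 < z ->
  25 * x ^+ 2 + 144 * y ^+ 2 = z ^+ 2 -> 4 * x ^+ 2 + 25 * y ^+ 2 = w ^+ 2 ->
  exists m n u v : int, [/\ 0 < m /\ 0 < n, m != n, m ^+ 2 + n ^+ 2 <= 2 * z,
    16 * m ^+ 2 + 9 * n ^+ 2 = u ^+ 2 & 9 * m ^+ 2 + 16 * n ^+ 2 = v ^+ 2].
Proof.
move=> x_gt0 y_gt0 z_gt0 zE wE.
have zx : 0 < z - 5 * x by nia.
have xz : 0 < z + 5 * x by lia.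
have xyz : (z + 5 * x) * (z - 5 * x) = (12 * y) ^+ 2 by nia.
have [t [m [n [t_gt0 m_gt0 n_gt0 mn [mE nE]]]]] := mul_sqr_split xz zx xyz.
have [d dE] : exists d,
    (16 * m ^+ 2 + 9 * n ^+ 2) * (9 * m ^+ 2 + 16 * n ^+ 2) = d ^+ 2.
  (* Times t, the factors are 25 z + 35 x and 25 z - 35 x, with product 625 z^2 - 1225 x^2 = 3600 (4
     x^2 + 25 y^2). *)
  apply: (@sqr_quotient t _ (60 * w)); first lia.
  rewrite exprMn -wE.
  transitivity ((16 * (z + 5 * x) + 9 * (z - 5 * x)) *
                (9 * (z + 5 * x) + 16 * (z - 5 * x))).
    by rewrite mE nE; ring.
  apply: subr0_eq.
  rewrite (_ : _ - _ = - 625 * (25 * x ^+ 2 + 144 * y ^+ 2 - z ^+ 2)); last ring.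
  by rewrite zE subrr mulr0.
have a_gt0 : 0 < 16 * m ^+ 2 + 9 * n ^+ 2 by nia.
have b_gt0 : 0 < 9 * m ^+ 2 + 16 * n ^+ 2 by nia.
have [g [u [v [g_gt0 _ _ _ [uE vE]]]]] := mul_sqr_split a_gt0 b_gt0 dE.
have g175 : (g %| 175%:Z)%Z.
  apply: (coprimez_dvd_mul_sqr mn).
    rewrite (_ : _ * _ = 16 * (16 * m ^+ 2 + 9 * n ^+ 2) -
                         9 * (9 * m ^+ 2 + 16 * n ^+ 2)); last ring.
    by rewrite uE vE rpredB // dvdz_mull ?dvdz_mulr.
  rewrite (_ : _ * _ = 16 * (9 * m ^+ 2 + 16 * n ^+ 2) -
                       9 * (16 * m ^+ 2 + 9 * n ^+ 2)); last ring.
  by rewrite uE vE rpredB // dvdz_mull ?dvdz_mulr.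
(* Modulo 7, 16 m^2 + 9 n^2 is 2 (m^2 + n^2), and -1 is not a square. *)
have g7 : ~ (7 %| g)%Z.
  move=> /dvdzP[k gE].
  have [] := @anisotropic_modP 7 1 m n; rewrite //.
    apply/dvdzP; exists (4 * k * u ^+ 2 - 9 * m ^+ 2 - 5 * n ^+ 2).
    apply: subr0_eq.
    rewrite (_ : _ - _ = 4 * (16 * m ^+ 2 + 9 * n ^+ 2 - k * 7 * u ^+ 2)); last ring.
    by rewrite uE gE subrr.
  by apply: coprimez_not_common.
(* Modulo 3, g = 5 would give m^2 + u^2 = n^2 + v^2 = 0, so 3 would divide both m and n. *)
have g5 : g <> 5.
  move=> gE.
  have [] := @anisotropic_modP 3 1 m u; rewrite //.
    by apply/dvdzP; exists (2 * u ^+ 2 - 5 * m ^+ 2 - 3 * n ^+ 2); lia.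
  have [] := @anisotropic_modP 3 1 n v; rewrite //.
    by apply/dvdzP; exists (2 * v ^+ 2 - 5 * n ^+ 2 - 3 * m ^+ 2); lia.
  by move=> n3 _ m3 _; apply: (coprimez_not_common mn _ m3 n3).
have [k gE] : exists k, g = k ^+ 2.
  case: (dvdz_divisors (isT : 0 < 175)%N g_gt0 g175) => e gE.
  rewrite (_ : divisors 175 = [:: 1; 5; 7; 25; 35; 175]%N) ?inE; last by vm_compute.
  do ?[case/predU1P=> [eE|]]; last move/eqP=> eE; move: g7 g5; rewrite gE eE //.
  - by exists 1.
  - by exists 5.
exists m, n, (k * u), (k * v); split=> //.
- apply/eqP => mn_eq; move: mE; rewrite mn_eq -nE => xz0.
  by move: x_gt0 xz0 {uE vE dE}; lia.
- have le_t (a : int) : a ^+ 2 <= t * a ^+ 2 by rewrite ler_peMl ?sqr_ge0 //; lia.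
  rewrite (_ : 2 * z = (z + 5 * x) + (z - 5 * x)); last ring.
  by rewrite mE nE lerD.
- by rewrite uE gE exprMn.
- by rewrite vE gE exprMn.
Qed.

(** As 576 = 2^6 3^2, the square classes are 1, 2, 3, 6. Squares prime to 5 are 1 or -1 modulo 5, so
    classes 2 and 3 have residue 2 or 3. *)
Lemma square_or_six_square (h : int) : 0 < h -> (h %| 576%:Z)%Z ->
  (h %% 5)%Z <> 2 -> (h %% 5)%Z <> 3 ->
  exists j k : int, [/\ 0 < k, j = 1 \/ j = 6 & h = j * k ^+ 2].
Proof.
move=> h_gt0 h576 h2 h3.
have [d hE dD] := dvdz_divisors (isT : 0 < 576)%N h_gt0 h576.
have classes : all (fun e : nat => [|| (e %% 5 == 2)%N, (e %% 5 == 3)%N |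
    has (fun k => (e == k ^ 2) || (e == 6 * k ^ 2))%N (iota 1 24)]) (divisors 576).
  by vm_compute.
move: classes => /allP/(_ d dD)/or3P[/eqP d2|/eqP d3|/hasP[k kI /orP[]/eqP dE]].
- by case: h2; rewrite hE modz_nat d2.
- by case: h3; rewrite hE modz_nat d3.
- exists 1, k%:Z; rewrite mul1r hE dE -!natz natrX; split; [|by left|by []].
  by move: kI; rewrite mem_iota; case: (k).
- exists 6, k%:Z; rewrite hE dE -!natz natrM natrX; split; [|by right|by []].
  by move: kI; rewrite mem_iota; case: (k).
Qed.

Lemma E2_twist_of_E1 (m n u v : int) :
  0 < m -> 0 < n -> 0 < u -> 0 < v -> m != n ->
  16 * m ^+ 2 + 9 * n ^+ 2 = u ^+ 2 -> 9 * m ^+ 2 + 16 * n ^+ 2 = v ^+ 2 ->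
  exists x y f c k : int, [/\ [/\ 0 < x, 0 < y, 0 < f, 0 < c & x != y],
    x ^+ 4 <= 625 * (m ^+ 2 + n ^+ 2), k = 1 \/ k = 6,
    25 * x ^+ 2 - y ^+ 2 = k * f ^+ 2 & 49 * x ^+ 2 - 25 * y ^+ 2 = k * c ^+ 2].
Proof.
move=> m_gt0 n_gt0 u_gt0 v_gt0 mn uE vE.
have X_gt0 : 0 < 4 * v + 3 * u by lia.
have Y_gt0 : 0 < 7 * (4 * v - 3 * u) by nia.
have W_gt0 : 0 < 4 * u - 3 * v by nia.
have XY : (4 * v + 3 * u) * (7 * (4 * v - 3 * u)) = (35 * n) ^+ 2 by nia.
have [g [x [y [g_gt0 x_gt0 y_gt0 xy [xE yE]]]]] := mul_sqr_split X_gt0 Y_gt0 XY.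
have [d dE] : exists d,
    (25 * x ^+ 2 - y ^+ 2) * (49 * x ^+ 2 - 25 * y ^+ 2) = d ^+ 2.
  (* Times g, the factors are 24 (4 u + 3 v) and 168 (4 u - 3 v), and 16 u^2 - 9 v^2 = 175 m^2. *)
  apply: (@sqr_quotient g _ (840 * m)); first lia.
  transitivity ((25 * (g * x ^+ 2) - g * y ^+ 2) *
                (49 * (g * x ^+ 2) - 25 * (g * y ^+ 2))); first ring.
  by rewrite -xE -yE; nia.
have a_gt0 : 0 < 25 * x ^+ 2 - y ^+ 2.
  rewrite -(pmulr_rgt0 _ g_gt0) (_ : g * _ = 25 * (g * x ^+ 2) - g * y ^+ 2); last ring.
  by rewrite -xE -yE; lia.
have b_gt0 : 0 < 49 * x ^+ 2 - 25 * y ^+ 2.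
  rewrite -(pmulr_rgt0 _ g_gt0) (_ : g * _ = 49 * (g * x ^+ 2) - 25 * (g * y ^+ 2)).
    by rewrite -xE -yE; lia.
  by ring.
have [h [f [c [h_gt0 f_gt0 c_gt0 _ [fE cE]]]]] := mul_sqr_split a_gt0 b_gt0 dE.
have h576 : (h %| 576%:Z)%Z.
  apply: (coprimez_dvd_mul_sqr xy).
    rewrite (_ : _ * _ = 25 * (25 * x ^+ 2 - y ^+ 2) -
                         (49 * x ^+ 2 - 25 * y ^+ 2)); last ring.
    by rewrite fE cE (mulrCA 25) rpredB // dvdz_mulr.
  rewrite (_ : _ * _ = 49 * (25 * x ^+ 2 - y ^+ 2) -
                       25 * (49 * x ^+ 2 - 25 * y ^+ 2)); last ring.
  by rewrite fE cE rpredB // dvdz_mull ?dvdz_mulr.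
(* If h = r modulo 5, then y^2 + r f^2 and x^2 + r c^2 vanish modulo 5, so 5 divides both x and
   y. *)
have non_residue (r : int) : anisotropic_mod 5 r -> (h %% 5)%Z <> r.
  move=> ani hr; have hE : h = (h %/ 5)%Z * 5 + r by rewrite -hr -divz_eq.
  have [] := @anisotropic_modP 5 r y f isT ani.
    apply/dvdzP; exists (5 * x ^+ 2 - (h %/ 5)%Z * f ^+ 2).
    apply: subr0_eq.
    rewrite (_ : _ - _ = ((h %/ 5)%Z * 5 + r) * f ^+ 2 - (25 * x ^+ 2 - y ^+ 2)).
      by rewrite -hE fE subrr.
    by ring.
  move=> y5 _.
  have [] := @anisotropic_modP 5 r x c isT ani.
    apply/dvdzP; exists (10 * x ^+ 2 - 5 * y ^+ 2 - (h %/ 5)%Z * c ^+ 2).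
    apply: subr0_eq.
    rewrite (_ : _ - _ = ((h %/ 5)%Z * 5 + r) * c ^+ 2 -
                         (49 * x ^+ 2 - 25 * y ^+ 2)).
      by rewrite -hE cE subrr.
    by ring.
  by move=> x5 _; apply: (coprimez_not_common xy _ x5 y5).
have x_neq_y : x != y.
  apply: contra_neq mn => xyE.
  have uv : u = v by move: xE; rewrite xyE -yE; clear; lia.
  apply/eqP; rewrite -(eqrXn2 (isT : 0 < 2)%N (ltW m_gt0) (ltW n_gt0)).
  by move: uE vE; rewrite uv; clear; lia.
have x4 : x ^+ 4 <= 625 * (m ^+ 2 + n ^+ 2).
  rewrite (_ : 625 * _ = 25 * (16 * m ^+ 2 + 9 * n ^+ 2) +
                         25 * (9 * m ^+ 2 + 16 * n ^+ 2)); last ring.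
  rewrite uE vE (_ : _ + _ = (4 * v + 3 * u) ^+ 2 + (4 * u - 3 * v) ^+ 2); last ring.
  rewrite ler_wpDr ?sqr_ge0 // xE exprMn (_ : x ^+ 4 = (x ^+ 2) ^+ 2); last ring.
  by rewrite ler_peMl ?sqr_ge0 // exprn_ege1.
have [j [k [k_gt0 jE hE]]] := square_or_six_square h_gt0 h576
  (non_residue 2 isT) (non_residue 3 isT).
exists x, y, (k * f), (k * c), j; rewrite !mulr_gt0 // fE cE hE.
by split=> //; ring.
Qed.

Lemma ler_of_sqr (a b : int) : 0 <= b -> a ^+ 2 <= b ^+ 2 -> a <= b.
Proof.
move=> b_ge0; case: (lerP a 0) => [a_le0 _|a_gt0]; first exact: le_trans b_ge0.
by rewrite ler_pXn2r // nnegrE ltW.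
Qed.

Lemma E2_of_E2_twist (x y f c k : int) :
  0 < x -> 0 < y -> 0 < f -> 0 < c -> x != y -> k = 1 \/ k = 6 ->
  25 * x ^+ 2 - y ^+ 2 = k * f ^+ 2 -> 49 * x ^+ 2 - 25 * y ^+ 2 = k * c ^+ 2 ->
  exists x' y' z' w' : int, [/\ 0 < x' /\ 0 < y', 0 < z', z' <= 35 * x,
    25 * x' ^+ 2 + 144 * y' ^+ 2 = z' ^+ 2 & 4 * x' ^+ 2 + 25 * y' ^+ 2 = w' ^+ 2].
Proof.
move=> x_gt0 y_gt0 f_gt0 c_gt0 xy [] ->; rewrite ?mul1r => fE cE.
  exists c, (2 * y), (7 * f), (14 * x); rewrite !mulr_gt0 // !exprMn -fE -cE.
  split=> //; [|ring|ring].
  rewrite (_ : 35 * x = 7 * (5 * x)) ?ler_pM2l //; last ring.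
  apply: ler_of_sqr; first by rewrite mulr_ge0 // ltW.
  by rewrite -fE exprMn gerBl ?sqr_ge0.
pose X := x * f + y * c; pose Y := x * f - y * c.
have X_gt0 : 0 < 6 * X by rewrite mulr_gt0 // addr_gt0 ?mulr_gt0.
have XY : (6 * X) * Y = (5 * (x ^+ 2 - y ^+ 2)) ^+ 2.
  transitivity (x ^+ 2 * (6 * f ^+ 2) - y ^+ 2 * (6 * c ^+ 2)).
    by rewrite /X /Y; ring.
  by rewrite -fE -cE; ring.
have Y_gt0 : 0 < Y.
  rewrite -(pmulr_rgt0 _ X_gt0) XY exprn_even_gt0 //= mulf_neq0 //.
  rewrite subr_eq0 eqrXn2 ?(ltW x_gt0) ?(ltW y_gt0) //.
have [g [p [q [g_gt0 p_gt0 q_gt0 pq [pE qE]]]]] := mul_sqr_split X_gt0 Y_gt0 XY.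
have [d dE] : exists d,
    (25 * p ^+ 2 + 144 * q ^+ 2) * (4 * p ^+ 2 + 25 * q ^+ 2) = d ^+ 2.
  (* Times g, the factors are 6 (49 x f + y c) and 49 x f - y c. *)
  apply: (@sqr_quotient g _ (245 * x ^+ 2 - 5 * y ^+ 2)); first by rewrite gt_eqF.
  transitivity ((25 * (g * p ^+ 2) + 144 * (g * q ^+ 2)) *
                (4 * (g * p ^+ 2) + 25 * (g * q ^+ 2))); first ring.
  rewrite -pE -qE.
  transitivity (2401 * x ^+ 2 * (6 * f ^+ 2) - y ^+ 2 * (6 * c ^+ 2)).
    by rewrite /X /Y; ring.
  by rewrite -fE -cE; ring.
have a_gt0 : 0 < 25 * p ^+ 2 + 144 * q ^+ 2 by rewrite addr_gt0 // mulr_gt0 ?exprn_gt0.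
have b_gt0 : 0 < 4 * p ^+ 2 + 25 * q ^+ 2 by rewrite addr_gt0 // mulr_gt0 ?exprn_gt0.
have [h [z [w [h_gt0 z_gt0 _ _ [zE wE]]]]] := mul_sqr_split a_gt0 b_gt0 dE.
have h49 : (h %| 49%:Z)%Z.
  apply: (coprimez_dvd_mul_sqr pq).
    rewrite (_ : _ * _ = 25 * (25 * p ^+ 2 + 144 * q ^+ 2) -
                         144 * (4 * p ^+ 2 + 25 * q ^+ 2)); last ring.
    by rewrite zE wE rpredB // dvdz_mull ?dvdz_mulr.
  rewrite (_ : _ * _ = 25 * (4 * p ^+ 2 + 25 * q ^+ 2) -
                       4 * (25 * p ^+ 2 + 144 * q ^+ 2)); last ring.
  by rewrite zE wE rpredB // dvdz_mull ?dvdz_mulr.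
have h7 : ~ (7 %| h)%Z.
  move=> h7; have [] := @anisotropic_modP 7 1 p q isT isT.
    rewrite (_ : _ + _ = 2 * (25 * p ^+ 2 + 144 * q ^+ 2) -
                         7 * (7 * p ^+ 2 + 41 * q ^+ 2)); last ring.
    by rewrite zE (mulrCA 2) rpredB ?dvdz_mulr.
  by apply: coprimez_not_common.
have h1 : h = 1.
  have [e hE] := dvdz_divisors (isT : 0 < 49)%N h_gt0 h49.
  rewrite (_ : divisors 49 = [:: 1; 7; 49]%N) ?inE; last by vm_compute.
  by case/or3P=> /eqP eE; move: h7; rewrite hE eE.
rewrite h1 !mul1r in zE wE.
exists p, q, z, w; split=> //.
apply: (@le_trans _ _ (25 * x)); last by rewrite ler_wpM2r // ltW.
apply: ler_of_sqr; first by rewrite mulr_ge0 // ltW.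
(* From 6 f^2 <= 25 x^2. As y c < x f, z^2 <= 6 (49 x f + y c) <= 300 x f, and 300 * 100 / 48 =
   25^2. *)
have f48 : 48 * f <= 100 * x.
  apply: ler_of_sqr; first by rewrite mulr_ge0 // ltW.
  by move: (sqr_ge0 y) (sqr_ge0 x) fE; rewrite !exprMn; clear; lia.
have yc : 0 < y * c by rewrite mulr_gt0.
apply: (@le_trans _ _ (300 * (x * f))).
  rewrite -zE (@le_trans _ _ (g * (25 * p ^+ 2 + 144 * q ^+ 2))) //.
    by rewrite ler_peMl ?(ltW a_gt0).
  rewrite mulrDr (mulrCA g 25) (mulrCA g 144) -pE -qE /X.
  by move: Y_gt0 yc; rewrite /Y; clear; lia.
by move: (ler_wpM2l (ltW x_gt0) f48); rewrite exprMn; clear; lia.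
Qed.

(** * Small solutions and the infinite descent *)

(* In [Z] because [nat] and [int] are unary: the table below is computed. *)
Definition binary_form (s t m n : nat) : Z :=
  Z.add (Z.mul (Z.of_nat s) (Z.square (Z.of_nat m)))
        (Z.mul (Z.of_nat t) (Z.square (Z.of_nat n))).

Definition is_squareZ (z : Z) : bool := Z.eqb (Z.square (Z.sqrt z)) z.

Lemma binary_form_square (s t m n u : nat) :
  s%:Z * m%:Z ^+ 2 + t%:Z * n%:Z ^+ 2 = u%:Z ^+ 2 -> is_squareZ (binary_form s t m n).
Proof.
move=> uE; have -> : binary_form s t m n = Z.square (Z.of_nat u).
  by rewrite /binary_form !Z.square_spec; lia.
by rewrite /is_squareZ !Z.square_spec Z.sqrt_square ?Z.eqb_refl //; lia.
Qed.

Lemma small_E1 (m n u v : int) : 0 < m <= 49 -> 0 < n <= 49 ->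
  16 * m ^+ 2 + 9 * n ^+ 2 = u ^+ 2 -> 9 * m ^+ 2 + 16 * n ^+ 2 = v ^+ 2 -> m = n.
Proof.
case: m n => [m|//] [n|//] => m49 n49 uE vE.
have table : all (fun a => all (fun b => [|| a == b,
    ~~ is_squareZ (binary_form 16 9 a b) | ~~ is_squareZ (binary_form 9 16 a b)])
    (iota 1 49)) (iota 1 49) by vm_compute.
have mI : m \in iota 1 49 by rewrite mem_iota; lia.
have nI : n \in iota 1 49 by rewrite mem_iota; lia.
move: table => /allP/(_ m mI)/allP/(_ n nI).
rewrite (@binary_form_square 16 9 m n `|u|) ?(@binary_form_square 9 16 m n `|v|).
- by rewrite orbF => /eqP->.
- by rewrite abszE real_normK ?num_real.
- by rewrite abszE real_normK ?num_real.
Qed.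

Lemma E1_points (m n u v : int) : 0 < m -> 0 < n ->
  16 * m ^+ 2 + 9 * n ^+ 2 = u ^+ 2 -> 9 * m ^+ 2 + 16 * n ^+ 2 = v ^+ 2 -> m = n.
Proof.
have [N] := ubnP `|(m ^+ 2 + n ^+ 2)%R|%N.
elim: N => // N IHN in m n u v *; rewrite ltnS => leN m_gt0 n_gt0 uE vE.
apply/eqP/negPn/negP => mn.
have sqr_abs (a : int) : `|a| ^+ 2 = a ^+ 2 by rewrite real_normK ?num_real.
have form_gt0 (s t : int) : 0 < s -> 0 < t -> 0 < s * m ^+ 2 + t * n ^+ 2.
  by move=> s_gt0 t_gt0; rewrite addr_gt0 // mulr_gt0 ?exprn_gt0.
have abs_gt0 (a : int) : 0 < a ^+ 2 -> 0 < `|a|.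
  by rewrite normr_gt0; apply: contraTneq => ->.
have u_gt0 : 0 < `|u| by rewrite abs_gt0 // -uE form_gt0.
have v_gt0 : 0 < `|v| by rewrite abs_gt0 // -vE form_gt0.
rewrite -(sqr_abs u) in uE; rewrite -(sqr_abs v) in vE.
have [x [y [f [c [k [[x_gt0 y_gt0 f_gt0 c_gt0 xy] x4 kE fE cE]]]]]] :=
  E2_twist_of_E1 m_gt0 n_gt0 u_gt0 v_gt0 mn uE vE.
have [x' [y' [z' [w' [[x'_gt0 y'_gt0] z'_gt0 z'x zE wE]]]]] :=
  E2_of_E2_twist x_gt0 y_gt0 f_gt0 c_gt0 xy kE fE cE.
have [m' [n' [u' [v' [[m'_gt0 n'_gt0] mn' le_z u'E v'E]]]]] :=
  E1_of_E2 x'_gt0 y'_gt0 z'_gt0 zE wE.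
have [lt_N|ge_N] := ltP (m' ^+ 2 + n' ^+ 2) (m ^+ 2 + n ^+ 2).
  move/eqP: mn'; apply; apply: (IHN m' n' u' v') => //.
  apply: leq_trans leN; rewrite -ltz_nat !gez0_abs //.
  - by rewrite addr_ge0 ?sqr_ge0.
  - by rewrite addr_ge0 ?sqr_ge0.
(* Without a decrease, s = m^2 + n^2 <= 70 x and x^4 <= 625 s give x^3 <= 43750 < 36^3, hence s <=
   2450 < 50^2. *)
have s_le : m ^+ 2 + n ^+ 2 <= 70 * x.
  by move: ge_N le_z z'x; clear; lia.
have x_le : x <= 35.
  rewrite leNgt; apply/negP => x_gt.
  have x3_le : x ^+ 3 <= 625 * 70.
    rewrite -(ler_pM2l x_gt0) -exprS; apply: le_trans x4 _.
    by move: s_le; clear; lia.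
  have x3_ge : 36 * 36 * 36 <= x ^+ 3.
    by rewrite -!mulrA -!expr2 -exprS ler_pXn2r ?nnegrE ?(ltW x_gt0).
  by move: x3_le x3_ge; clear; lia.
have le49 (a : int) : 0 < a -> a ^+ 2 <= 70 * 35 -> a <= 49.
  by move=> a_gt0 a2; move: a_gt0 a2; clear; nia.
move/eqP: mn; apply; apply: (small_E1 _ _ uE vE).
- rewrite m_gt0 le49 //; move: s_le x_le (sqr_ge0 n); clear; lia.
- rewrite n_gt0 le49 //; move: s_le x_le (sqr_ge0 m); clear; lia.
Qed.

(** * Rational solutions and the four distances *)

Lemma E1_rational_points (R : realType) (x y u v : R) :
  rational x -> rational y -> rational u -> rational v -> 0 < x -> 0 < y ->
  16 * x ^+ 2 + 9 * y ^+ 2 = u ^+ 2 -> 9 * x ^+ 2 + 16 * y ^+ 2 = v ^+ 2 -> x = y.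
Proof.
move=> [a _ aE] [b _ bE] [p _ pE] [q _ qE] x_gt0 y_gt0 uE vE.
(* Both equations are homogeneous, so a common denominator scales the solution to an integral
   one. *)
pose d := denq a * denq b * denq p * denq q.
have d_gt0 : 0 < d%:~R :> R by rewrite ltr0z !mulr_gt0 ?denq_gt0.
have scaled (c : rat) (k : int) : k * denq c = d ->
    {n : int | ratr c * d%:~R = n%:~R :> R}.
  move=> <-; exists (k * numq c); rewrite !intrM /ratr; field.
  by rewrite intr_eq0 denq_neq0.
have [X] : {n | ratr a * d%:~R = n%:~R :> R}.
  by apply: (scaled a (denq b * denq p * denq q)); rewrite /d; ring.
have [Y] : {n | ratr b * d%:~R = n%:~R :> R}.
  by apply: (scaled b (denq a * denq p * denq q)); rewrite /d; ring.
have [u'] : {n | ratr p * d%:~R = n%:~R :> R}.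
  by apply: (scaled p (denq a * denq b * denq q)); rewrite /d; ring.
have [v'] : {n | ratr q * d%:~R = n%:~R :> R}.
  by apply: (scaled q (denq a * denq b * denq p)); rewrite /d; ring.
rewrite aE bE pE qE => vE' uE' YE XE.
have form (s t : int) (w : R) (w' : int) : w * d%:~R = w'%:~R ->
    s%:~R * x ^+ 2 + t%:~R * y ^+ 2 = w ^+ 2 -> s * X ^+ 2 + t * Y ^+ 2 = w' ^+ 2.
  move=> ww' wE; apply: (@intr_inj R).
  by rewrite !(rmorphXn, rmorphM, rmorphD) /= -XE -YE -ww' !exprMn -wE; ring.
apply: (mulIf (lt0r_neq0 d_gt0)); rewrite XE YE; congr (_%:~R).
apply: (@E1_points X Y u' v').
- by rewrite -(ltr0z R) -XE mulr_gt0.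
- by rewrite -(ltr0z R) -YE mulr_gt0.
- exact: (form 16 9 u).
- exact: (form 9 16 v).
Qed.

Theorem theorem6p8 (R : realType) (U A V B : R * R)
    (hU : U = (0, 0)) (hA : A = (18, 24)) (hV : V = (50, 0))
    (hB : B = (32, -24)) :
  [set P : R * R | [/\ rational_point P, open_segment U V P
     & [/\ rational (edist P U), rational (edist P V),
           rational (edist P A) & rational (edist P B)]]]
  = [set (25, 0)].
Proof.
rewrite {}hU {}hA {}hV {}hB; apply/seteqP; split => P /=.
  move=> [[xQ _] [t /= /andP[t_gt0 t_lt1] PE] [_ _ uQ vQ]].
  move: PE xQ uQ vQ; rewrite /edist; case: P => x y /= [<- <-].
  rewrite !mulr0 !add0r => xQ uQ vQ.
  have mulQ (n : nat) (r : R) : rational r -> rational (n%:R * r).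
    by move=> [c _ <-]; exists (n%:R * c); rewrite // rmorphM /= ratr_nat.
  have subQ (n : nat) (r : R) : rational r -> rational (n%:R - r).
    by move=> [c _ <-]; exists (n%:R - c); rewrite // rmorphB /= ratr_nat.
  (* The factor 5 comes from 25 PA^2 = 16 x^2 + 9 (50 - x)^2 and 25 PB^2 = 9 x^2 + 16 (50 - x)^2. *)
  have x_eq : t * 50 = 50 - t * 50.
    have x_gt0 : 0 < t * 50 by lra.
    have y_gt0 : 0 < 50 - t * 50 by lra.
    apply: (E1_rational_points xQ (subQ 50 _ xQ) (mulQ 5 _ uQ) (mulQ 5 _ vQ)) => //.
      by rewrite [RHS]exprMn sqr_sqrtr ?addr_ge0 ?sqr_ge0 //; ring.
    by rewrite [RHS]exprMn sqr_sqrtr ?addr_ge0 ?sqr_ge0 //; ring.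
  by congr pair; lra.
(* Conversely, the four points lie on the circle of radius 25 about (25, 0). *)
move=> ->; have rat_nat n : rational (n%:R : R) by exists n%:R => //; rewrite ratr_nat.
have sqrt_nat (w : R) n : w = n%:R ^+ 2 -> rational (Num.sqrt w).
  by move=> ->; rewrite sqrtr_sqr ger0_norm.
split; first by split; [exact: (rat_nat 25) | exact: (rat_nat 0)].
  exists (1 / 2); first by rewrite /=; lra.
  by congr pair; rewrite /=; lra.
rewrite /edist /=; split.
- by apply: (sqrt_nat _ 25); ring.
- by apply: (sqrt_nat _ 25); ring.
- by apply: (sqrt_nat _ 25); ring.
- by apply: (sqrt_nat _ 25); ring.
Qed.
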